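(* There is an angelic space without the Ramsey property.
   Context: A Hausdorff topological space $X$ is angelic if (i) every relatively countably compact subset of $X$ is relatively compact, and (ii) for every relatively compact $A\subseteq X$ and every $x\in\overline{A}$ there is a sequence $\{x_n:n\in\omega\}\subseteq A$ converging to $x$. (A subset is relatively compact if its closure in $X$ is compact; it is relatively countably compact if every sequence in it has a cluster point in $X$.) A space $X$ has the Ramsey property if for every function $f:[\omega]^2\to X$ and every $x\in X$ such that $\lim_{i\to\infty}\lim_{j\to\infty}f(\{i,j\})=x$ (i.e. for each $i$ the limit $x_i=\lim_{j\to\infty}f(\{i,j\})$ exists and $x_i\to x$), there is an infinite $M\subseteq\omega$ such that for every open $U\ni x$ there is $k\in\omega$ with $f(\{i,j\})\in U$ for all $i<j$ in $M\setminus k$. *)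

(* Defs.v *)
From mathcomp Require Import all_boot finmap.
From mathcomp Require Import all_classical topology.

Set Implicit Arguments.
Unset Strict Implicit.
Unset Printing Implicit Defensive.

Local Open Scope classical_set_scope.

Definition relatively_compact (X : topologicalType) (A : set X) : Prop :=
  compact (closure A).

Definition relatively_countably_compact (X : topologicalType) (A : set X) :
    Prop :=
  forall u : nat -> X, (forall n, A (u n)) -> exists x : X, cluster (u @ \oo) x.

Definition angelic (X : topologicalType) : Prop :=
  [/\ hausdorff_space X,
      forall A : set X,
        relatively_countably_compact A -> relatively_compact A
    & forall A : set X, relatively_compact A ->
        forall x : X, closure A x ->
          exists2 u : nat -> X, forall n, A (u n) & u @ \oo --> x].

(* The set of two-element subsets of the natural numbers. *)
Definition pairs : Type := {A : {fset nat} | #|` A|%fset == 2}.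

Fact card_pair01 : #|` [fset 0; 1]|%fset == 2.
Proof. by rewrite cardfs2. Qed.

(* The two-element set {i, j}; the value {0, 1} when i = j is arbitrary and
   does not affect the Ramsey property below: for fixed i, a limit as j tends
   to infinity ignores j = i, and the conclusion only involves i < j. *)
Definition pair_of (i j : nat) : pairs :=
  insubd (exist _ [fset 0; 1]%fset card_pair01 : pairs) [fset i; j]%fset.

Definition ramsey_property (X : topologicalType) : Prop :=
  forall (f : pairs -> X) (x : X) (x_ : nat -> X),
    (forall i, f (pair_of i j) @[j --> \oo] --> x_ i) ->
    x_ i @[i --> \oo] --> x ->
    exists2 M : set nat, infinite_set M &
      forall U : set X, open U -> U x ->
        exists k : nat, forall i j : nat,
          M i -> M j -> k <= i -> i < j -> U (f (pair_of i j)).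

(* Main.v *)
(** The example is Arens's space: points [leaf i j] are isolated, [leaf i j]
    tends to [spine i] as j grows, [spine i] tends to [apex], and the topology
    is the finest one with these convergences. A relatively countably compact
    set meets only finitely many columns of leaves, since a set of leaves with
    finitely many points in each column is closed and discrete; what remains is
    a finite union of convergent sequences, which is compact and
    first-countable. Hence the space is angelic, although it is not
    Fréchet-Urysohn. The function {i < j} |-> [leaf i j] has iterated limit
    [apex], but for infinite M, deleting [leaf i j] for j <= g i, where
    i < g i in M, leaves a neighbourhood of [apex]. *)
Require Import Defs.
From HB Require Import structures.
From mathcomp Require Import all_boot finmap.
From mathcomp Require Import all_classical topology.

Set Implicit Arguments.
Unset Strict Implicit.
Unset Printing Implicit Defensive.

Local Open Scope classical_set_scope.

Definition arens : Type := option (nat * option nat).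

Definition apex : arens := None.
Definition spine (i : nat) : arens := Some (i, None).
Definition leaf (i j : nat) : arens := Some (i, Some j).

Lemma arensP (P : arens -> Prop) :
  P apex -> (forall i, P (spine i)) -> (forall i j, P (leaf i j)) ->
  forall x, P x.
Proof. by move=> Pa Ps Pl [[i [j|]]|]; [exact: Pl|exact: Ps|exact: Pa]. Qed.

Definition arens_open (U : set arens) : Prop :=
  (U apex -> \forall i \near \oo, U (spine i)) /\
  (forall i, U (spine i) -> \forall j \near \oo, U (leaf i j)).

Lemma arens_openT : arens_open setT.
Proof. by split=> *; near=> n. Unshelve. all: by end_near. Qed.

Lemma arens_openI : setI_closed arens_open.
Proof.
move=> U V [Ua Us] [Va Vs]; split=> [[/Ua Ux /Va Vx]|i [/Us Ux /Vs Vx]];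
  exact: filterI.
Qed.

Lemma arens_open_bigU (I : Type) (F : I -> set arens) :
  (forall k, arens_open (F k)) -> arens_open (\bigcup_k F k).
Proof.
move=> oF; split=> [[k _ Fk]|i [k _ Fk]]; have [Fa Fs] := oF k.
  by apply: filterS (Fa Fk) => i; exists k.
by apply: filterS (Fs _ Fk) => j; exists k.
Qed.

HB.instance Definition _ := Choice.on arens.
HB.instance Definition _ :=
  isOpenTopological.Build arens arens_openT arens_openI arens_open_bigU.

Lemma openP (U : set arens) : open U <-> arens_open U.
Proof. by []. Qed.

Lemma cvg_spine : spine i @[i --> \oo] --> apex.
Proof.
move=> U; rewrite nbhsE => -[V [[Va _] Vx] VU].
by apply: filterS (Va Vx) => i; exact: VU.
Qed.

Lemma cvg_leaf i : leaf i j @[j --> \oo] --> spine i.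
Proof.
move=> U; rewrite nbhsE => -[V [[_ Vs] Vx] VU].
by apply: filterS (Vs _ Vx) => j; exact: VU.
Qed.

(* A countable neighbourhood base at [x] relative to each [core n] below; at
   [apex] it is not a base of the whole space. *)
Definition basic (x : arens) (m : nat) : set arens :=
  match x with
  | None => [set y | if y is Some (i, _) then m <= i else True]
  | Some (i, None) => [set y | if y is Some (k, Some j) then k = i /\ m <= j
                               else y = spine i]
  | Some (i, Some j) => [set leaf i j]
  end.

Lemma basic_center x m : basic x m x.
Proof. by elim/arensP: x. Qed.

Lemma open_basic x m : open (basic x m).
Proof.
apply/openP; elim/arensP: x => [|i|i j]; split=> //=.
- by move=> _; near=> i; near: i; exact: nbhs_infty_ge.
- by move=> i mi; near=> j.
- move=> k [->]; near=> j; split=> //; near: j; exact: nbhs_infty_ge.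
Unshelve. all: by end_near. Qed.

Lemma nbhs_basic x m : nbhs x (basic x m).
Proof.
by apply: open_nbhs_nbhs; split; [exact: open_basic|exact: basic_center].
Qed.

(** A large [m] pushes the neighbourhood of [apex] past the column of the other point, and that of a
    spine point past the row of a leaf; in the remaining cases [m = 0] works. *)
Lemma basic_disjoint x y : x != y ->
  exists m, basic x m `&` basic y m = set0.
Proof.
move=> xy; suff [m mP] : exists m, forall z, basic x m z -> basic y m z -> False.
  by exists m; apply/seteqP; split=> z // [/mP].
elim/arensP: x xy => [|i|i j]; elim/arensP: y => [|k|k l] //= xy.
- by exists k.+1; elim/arensP => [|i|i j] //= ki [] ik; rewrite ik ltnn in ki.
- by exists k.+1 => z /[swap] ->; rewrite /= ltnn.
- by exists i.+1; elim/arensP => [|k|k l] //= [] ki; rewrite ki ltnn.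
- exists 0; elim/arensP => [|a|a b] //=.
    by move=> -> [ik]; rewrite ik eqxx in xy.
  by move=> [-> _] [ik]; rewrite ik eqxx in xy.
- by exists l.+1 => z /[swap] ->; rewrite /= ltnn => -[].
- by exists i.+1 => z -> /=; rewrite ltnn.
- by exists j.+1 => z -> /=; rewrite ltnn => -[].
- by exists 0 => z -> ij; rewrite ij eqxx in xy.
Qed.

Lemma arens_hausdorff : hausdorff_space arens.
Proof.
rewrite open_hausdorff => x y /basic_disjoint[m xy0].
exists (basic x m, basic y m); first by rewrite !inE; split; exact: basic_center.
by split; [exact: open_basic|exact: open_basic|exact/eqP].
Qed.

(** A filter that does not cluster at [x] has a member missing a neighbourhood of [x], so it
    contains a finite initial part of the sequence and clusters there. *)
Lemma compact_cvg_range (T : topologicalType) (u : nat -> T) (x : T) :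
  u @ \oo --> x -> compact (x |` range u).
Proof.
move=> ux F PF FK.
have [Fx|nFx] := pselect (cluster F x); first by exists x; split=> //; left.
have : exists B V, [/\ F B, nbhs x V & B `&` V = set0].
  apply: contrapT => h; apply: nFx => B V FB xV.
  apply: contrapT => /set0P/negP/negPn/eqP BV0.
  by apply: h; exists B, V.
move=> [B [V [FB xV BV0]]].
have [N _ uV] := ux _ xV.
have FN : F (u @` `I_N).
  apply: filterS (filterI FK FB) => y [[->|[n _ <-]] By].
    have : (B `&` V) x by split=> //; exact: nbhs_singleton.
    by rewrite BV0.
  exists n => //=; rewrite ltnNge; apply/negP => Nn.
  have : (B `&` V) (u n) by split=> //; exact: uV.
  by rewrite BV0.
have [y [[n _ <-] Fy]] :=
  finite_compact (finite_image u (finite_II N)) PF FN.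
by exists (u n); split=> //; right; exists n.
Qed.

(** These compact sets absorb every relatively countably compact set, which reduces angelicity to a
    single [core n]. *)
Definition core (n : nat) : set arens :=
  [set x | if x is Some (i, Some _) then i < n else True].

Lemma compact_core n : compact (core n).
Proof.
have -> : core n = (apex |` range spine) `|`
    \big[setU/set0]_(i < n) (spine i |` range (leaf i)).
  rewrite -(bigcup_mkord n (fun i => spine i |` range (leaf i))).
  apply/seteqP; split.
    elim/arensP => [_|i _|i j /= ij].
    - by left; left.
    - by left; right; exists i.
    - by right; exists i => //; right; exists j.
  by move=> x [[->|[i _ <-]]|[i /= ij [->|[j _ <-]]]].
apply: compactU; first exact: compact_cvg_range cvg_spine.
by apply: bigsetU_compact => i _; exact: compact_cvg_range (@cvg_leaf i).
Qed.

Lemma closed_core n : closed (core n).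
Proof. exact: compact_closed arens_hausdorff (@compact_core n). Qed.

Lemma nbhs_core x n (U : set arens) : nbhs x U ->
  \forall m \near \oo, basic x m `&` core n `<=` U.
Proof.
rewrite nbhsE => -[V [[Va Vs] Vx] VU].
elim/arensP: x Vx => [/[dup] Vx /Va|i /[dup] Vx /Vs|i j Vx];
  [case=> N _ NV|case=> N _ NV|].
(* Once [n <= m], no leaf of [core n] lies in [basic apex m], so only spine points need [N]. *)
- exists (maxn N n) => // m /=; rewrite geq_max => /andP[Nm nm].
  elim/arensP => [|i|i j] /= [mi ci]; apply: VU => //.
  + by apply: NV; exact: leq_trans mi.
  + by have := leq_trans nm mi; rewrite leqNgt ci.
- exists N => // m Nm; elim/arensP => [|k|k j] /= [mi ci]; apply: VU => //.
  + by rewrite mi.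
  + by case: mi => -> mj; apply: NV; exact: leq_trans mj.
- by exists 0 => // m _ y /= [-> _]; exact: VU.
Qed.

Lemma compact_rcc (X : topologicalType) (A : set X) :
  relatively_compact A -> relatively_countably_compact A.
Proof.
move=> cA u Au; have [|x [_ ux]] := cA (u @ \oo) _; last by exists x.
by exists 0 => // n _; apply: subset_closure; exact: Au.
Qed.

Lemma rcc_sub_core (A : set arens) :
  relatively_countably_compact A -> exists n, A `<=` core n.
Proof.
move=> rccA; apply: contrapT => nA.
have /choice[v vP] : forall n, exists ij, n <= ij.1 /\ A (leaf ij.1 ij.2).
  move=> n; apply: contrapT => nv; apply: nA; exists n.
  elim/arensP => // i j Aij /=; rewrite ltnNge; apply/negP => ni.
  by apply: nv; exists (i, j).
pose u n := leaf (v n).1 (v n).2.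
have [p up] : exists p, cluster (u @ \oo) p by apply: rccA => n; have [] := vP n.
(* From index [N] on, the terms of [u] lie in columns beyond that of [p]; [apex] is in no column, so
   0 suffices for it. *)
pose N := if p is Some (i, _) then i.+1 else 0.
pose V := ~` (u @` [set n | N <= n]).
have oV : open V.
  apply/openP; split=> [_|i _]; first by exists 0 => // i _ [].
  (* The term [u n] lies in a column at least [n], so only terms with [n <= i] can meet column [i],
     and their rows are bounded. *)
  exists (\max_(n < i.+1) (v n).2).+1 => // j /= vj [n _ [vi vnj]].
  have ni : n < i.+1 by rewrite ltnS -vi; have [] := vP n.
  have := @leq_bigmax 'I_i.+1 (fun n => (v n).2) (Ordinal ni).
  by rewrite /= vnj leqNgt vj.
have Vp : V p.
  move=> [n /= Nn unp]; move: Nn; rewrite /N -unp /u /=.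
  by rewrite ltnNge; have [-> _] := vP n.
have /(_ (~` V) V)[||x []//] := up.
  by exists N => // n Nn; rewrite /V setCK; exists n.
exact: open_nbhs_nbhs.
Qed.

Lemma arens_angelic : angelic arens.
Proof.
have clcore (A : set arens) n : A `<=` core n -> closure A `<=` core n.
  move=> An x /(closure_subset An).
  by rewrite -((closure_id _).1 (@closed_core n)).
split; first exact: arens_hausdorff.
  move=> A /rcc_sub_core[n An].
  apply: subclosed_compact (@compact_core n) (clcore _ _ An).
  exact: closed_closure.
move=> A /compact_rcc/rcc_sub_core[n An] x Ax.
(* Within [core n], which contains [A], the sets [basic x m] shrink to [x], so any choice of points
   of [A] in them converges. *)
have /choice[u uP] : forall m, exists y, A y /\ basic x m y.
  by move=> m; exact: Ax (nbhs_basic x m).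
exists u => [m|U xU]; first by have [] := uP m.
apply: filterS (nbhs_core n xU) => m; apply.
by have [Au xu] := uP m; split=> //; exact: An.
Qed.

Definition pair_max (p : pairs) : nat := \max_(k <- val p) k.
(** Removing the larger of two elements from their sum leaves the smaller. *)
Definition pair_min (p : pairs) : nat := \sum_(k <- val p) k - pair_max p.

Lemma val_pair_of i j : i < j -> val (pair_of i j) = [fset i; j]%fset.
Proof. by move=> ij; rewrite val_insubd cardfs2 neq_ltn ij. Qed.

Lemma pair_max_of i j : i < j -> pair_max (pair_of i j) = j.
Proof.
move=> ij; rewrite /pair_max val_pair_of // big_fsetU1 ?big_seq_fset1 /=.
  by apply/maxn_idPr; exact: ltnW.
by rewrite inE neq_ltn ij.
Qed.

Lemma pair_min_of i j : i < j -> pair_min (pair_of i j) = i.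
Proof.
move=> ij; rewrite /pair_min pair_max_of // val_pair_of //.
rewrite big_fsetU1 ?big_seq_fset1 /= ?addnK //.
by rewrite inE neq_ltn ij.
Qed.

Lemma arens_not_ramsey : ~ ramsey_property arens.
Proof.
pose f p := leaf (pair_min p) (pair_max p).
have fE i j : i < j -> f (pair_of i j) = leaf i j.
  by move=> ij; rewrite /f pair_min_of // pair_max_of.
move=> /(_ f apex spine)[||M infM MP].
- move=> i; apply: cvg_trans (@cvg_leaf i); apply: near_eq_cvg.
  by exists i.+1 => // j /= ij; rewrite fE.
- exact: cvg_spine.
have /choice[g gP] : forall i, exists j, M j /\ i < j.
  move=> i; apply: contrapT => Mi; apply: infM.
  apply: sub_finite_set (finite_II i.+1) => j Mj /=; rewrite ltnNge.
  by apply/negP => ij; apply: Mi; exists j.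
pose U : set arens := [set x | if x is Some (i, Some j) then g i < j else True].
have oU : open U.
  by apply/openP; split=> [_|i _]; [exists 0|exists (g i).+1].
have [k kP] := MP U oU I.
(* With [i = g k] and [j = g i], both in [M], the point [leaf i j] is the last one that [U] omits
   from column [i]. *)
have [Mi ki] := gP k; have [Mj ij] := gP (g k).
by have := kP _ _ Mi Mj (ltnW ki) ij; rewrite fE //= ltnn.
Qed.

Theorem theorem4p6 :
  exists X : topologicalType, angelic X /\ ~ ramsey_property X.
Proof. by exists arens; split; [exact: arens_angelic|exact: arens_not_ramsey]. Qed.
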